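(* Let $\theta$ and $\alpha$ be inner functions and let $h=p\alpha$ with $p\in\mathbb C$, $|p|<1$. Then $$m_p^{\alpha\theta}=\frac{\sqrt{1-|p|^2}}{1-p\alpha\theta}$$ is an isometric multiplier from $K_\theta$ onto $\ker T_{\overline\theta-p\alpha}=\ker T_{\overline{\theta_{p\alpha}}}$, where $\theta_{p\alpha}=\dfrac{\theta-\overline{p\alpha}}{1-p\alpha\theta}$.
   Context: $H^2=H^2(\mathbb D)$ is the Hardy space of the unit disk, identified with a closed subspace of $L^2(\mathbb T)$, and $P^+:L^2(\mathbb T)\to H^2$ is the orthogonal projection. For $g\in L^\infty(\mathbb T)$, $T_g:H^2\to H^2$, $T_gf=P^+(gf)$. For $\theta$ inner, $K_\theta=\ker T_{\overline\theta}=H^2\ominus\theta H^2$. All these spaces carry the $L^2(\mathbb T)$ norm. An isometric multiplier from $\mathcal A$ onto $\mathcal B$ is a function $m$ such that $f\mapsto mf$ is an isometry from $\mathcal A$ onto $\mathcal B$. Functions such as $\theta_{p\alpha}$ are understood as functions on $\mathbb T$ (a.e.). *)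

(* Defs.v *)
From HB Require Import structures.
From mathcomp Require Import all_boot all_order all_algebra.
From mathcomp Require Import all_classical all_reals all_analysis.
From mathcomp.real_closed Require Import complex.

Set Implicit Arguments.
Unset Strict Implicit.
Unset Printing Implicit Defensive.

Import Order.TTheory GRing.Theory Num.Theory.
Import numFieldNormedType.Exports.

Local Open Scope classical_set_scope.
Local Open Scope ring_scope.
Local Open Scope complex_scope.

Section HardyToeplitz.
Context {R : realType}.
Implicit Types (f g u h m theta : R[i] -> R[i]) (A B : set (R[i] -> R[i])).

(* A function on the unit circle T is represented by a function on the whole
   complex plane of which only the values on T are ever used; T is
   parametrised by [expi] and carries normalised arc length. *)
Definition expi (t : R) : R[i] := cos t +i* sin t.

Lemma twopi_gt0 : (0 : R) < 2 * pi.
Proof. by rewrite mulr_gt0 // pi_gt0. Qed.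

Definition arc : probability (measurableTypeR R) R := uniform_prob twopi_gt0.

Definition eqT f g : Prop := {ae arc, forall t, f (expi t) = g (expi t)}.

Definition measurableT_fun f : Prop :=
  measurable_fun [set: R] (fun t : R => complex.Re (f (expi t))) /\
  measurable_fun [set: R] (fun t : R => complex.Im (f (expi t))).

Definition intT f : R[i] :=
  (\int[arc]_t complex.Re (f (expi t)))%R
    +i* (\int[arc]_t complex.Im (f (expi t)))%R.

Definition L2norm f : \bar R :=
  Lnorm arc 2%:E (fun t : R => (Normc.normc (f (expi t)))%:E).

Definition L2T : set (R[i] -> R[i]) :=
  [set f | measurableT_fun f /\ (L2norm f < +oo)%E].

Definition dotT f g : R[i] := intT (fun z => f z * conjc (g z)).

(* The power series [\sum_k a_k z^k] on the disk with square-summable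
   coefficients are the elements of H^2(D); such a series is identified with its
   boundary function, the sum of the same series in L^2(T). *)
Definition H2 : set (R[i] -> R[i]) :=
  [set f | L2T f /\ exists a : nat -> R[i],
     cvgn (series (fun k => Normc.normc (a k) ^+ 2)) /\
     L2norm (fun z => f z - \sum_(k < n) a k * z ^+ k) @[n --> \oo] --> 0%E].

Definition is_H2_projection u h : Prop :=
  H2 h /\ forall g, H2 g -> dotT (fun z => u z - h z) g = 0.

(* [is_H2_projection u] determines h up to equality a.e. on T; for u in L^2(T)
   such an h exists because H^2 is closed. *)
Definition Pplus u : R[i] -> R[i] := xget (fun=> 0) (is_H2_projection u).

Definition toeplitz g f : R[i] -> R[i] := Pplus (fun z => g z * f z).

Definition ker_toeplitz g : set (R[i] -> R[i]) :=
  [set f | H2 f /\ eqT (toeplitz g f) (fun=> 0)].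

(* The bounded analytic functions are the bounded elements of H^2. *)
Definition inner_function theta : Prop :=
  H2 theta /\ {ae arc, forall t, `|theta (expi t)| = 1}.

Definition model_space theta : set (R[i] -> R[i]) :=
  ker_toeplitz (fun z => conjc (theta z)).

Definition isometric_multiplier m A B : Prop :=
  [/\ forall f, A f -> B (fun z => m z * f z),
      forall f g, A f -> A g ->
        L2norm (fun z => m z * f z - m z * g z) = L2norm (fun z => f z - g z)
    & forall g, B g -> exists2 f, A f & eqT (fun z => m z * f z) g].

Definition crofoot_multiplier (p : R[i]) (w : R[i] -> R[i]) : R[i] -> R[i] :=
  fun z => (Num.sqrt (1 - Normc.normc p ^+ 2))%:C / (1 - p * w z).

Definition frostman_shift theta h : R[i] -> R[i] :=
  fun z => (theta z - conjc (h z)) / (1 - h z * theta z).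

End HardyToeplitz.

(* Main.v *)
From mathcomp Require Import all_boot all_order all_algebra.
From mathcomp Require Import all_classical all_reals all_analysis.
From mathcomp.real_closed Require Import complex.
From mathcomp Require Import measurable_realfun ring lra.
Require Import Defs.

Set Implicit Arguments.
Unset Strict Implicit.
Unset Printing Implicit Defensive.

Import Order.TTheory GRing.Theory Num.Theory.
Import numFieldNormedType.Exports.

Local Open Scope classical_set_scope.
Local Open Scope ring_scope.
Local Open Scope complex_scope.

(** Put x = p alpha theta, an H^2 function with |x| = |p| < 1 on T, and
    k = 1/(1 - x). Since k is the uniform limit of the geometric series in x,
    both k and its inverse 1 - x multiply H^2 into itself (H2_resolvent). The
    kernel of a Toeplitz operator T_g is the set of f in H^2 with g f orthogonal
    to H^2 (ker_toeplitzP), so the theorem is about orthogonality relations, and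
    on T, where conj theta theta = 1, these are related by

      conj theta - p alpha = conj theta (1 - x).

    With m = c k, c = sqrt(1 - |p|^2), this gives
    (conj theta - p alpha) (m f) = c (conj theta f), so that f lies in K_theta
    exactly when m f lies in ker T_(conj theta - p alpha); as m is an invertible
    multiplier of H^2, it maps the first space onto the second
    (crofoot_mul_ker, ker_crofoot_mul).

    The map is isometric although |m| is not 1: |m|^2 is the Poisson kernel
    1 + x k + conj (x k), and for f in K_theta the oscillating part vanishes,
    <x k f, f> = <p alpha k f, conj theta f> = 0, the left factor being in H^2
    (nsq_crofoot_mul).

    Finally the conjugate of the Frostman shift is (conj theta - p alpha) conj k,
    and <u conj k, g> = <u, k g> while k H^2 = H^2; so both symbols have the
    same kernel (ker_frostman).

    The analytic input is the description of H^2 as the L^2-closure of the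
    polynomials (H2P), which makes H^2 visibly closed and shift invariant, hence
    stable under its bounded elements (H2_bounded_mul), and the existence of the
    projection P^+ (H2_projection_rdot), for which a Fourier series with square
    summable coefficients has to be summed: this is the completeness of L^2(T)
    (L2T_complete). *)

(** * Complex numbers and measurability *)

Notation normc := Normc.normc.

Section ComplexAlgebra.
Context {R : realType}.
Implicit Types x y : R[i].

Lemma sqr_normcE x : normc x ^+ 2 = complex.Re x ^+ 2 + complex.Im x ^+ 2.
Proof. by case: x => a b; rewrite sqr_sqrtr// addr_ge0 ?sqr_ge0. Qed.

Lemma sqr_normc_ReJ x : normc x ^+ 2 = complex.Re (x * conjc x).
Proof. by rewrite sqr_normcE; case: x => a b /=; ring. Qed.

Lemma sqr_normcD x y :
  normc (x + y) ^+ 2 =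
  normc x ^+ 2 + normc y ^+ 2 + 2 * complex.Re (x * conjc y).
Proof. by rewrite !sqr_normcE; case: x y => [a b] [c d] /=; ring. Qed.

Lemma sqr_normcM x y : normc (x * y) ^+ 2 = normc x ^+ 2 * normc y ^+ 2.
Proof. by rewrite Normc.normcM exprMn. Qed.

Lemma normr_ReJ_le x y :
  `|complex.Re (x * conjc y)| <= normc x ^+ 2 + normc y ^+ 2.
Proof.
rewrite !sqr_normcE; case: x y => [a b] [c d] /=; rewrite ler_norml.
have h1 := sqr_ge0 (a + c); have h2 := sqr_ge0 (b + d).
have h3 := sqr_ge0 (a - c); have h4 := sqr_ge0 (b - d).
have h5 := sqr_ge0 a; have h6 := sqr_ge0 b.
have h7 := sqr_ge0 c; have h8 := sqr_ge0 d.
by apply/andP; split; nra.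
Qed.

Lemma normc_ge0 x : 0 <= normc x. Proof. by case: x => a b; exact: sqrtr_ge0. Qed.

Lemma normr_normcE x : `|x| = (normc x)%:C. Proof. by []. Qed.

Lemma normr_Re_le x : `|complex.Re x| <= normc x.
Proof. by have := normc_ge_Re x; rewrite normr_normcE lecR. Qed.

Lemma normr_Im_le x : `|complex.Im x| <= normc x.
Proof.
case: x => a b /=; rewrite -sqrtr_sqr ler_wsqrtr//.
by rewrite lerDr sqr_ge0.
Qed.

Lemma mulcJ_unit x : `|x| = 1 -> conjc x * x = 1.
Proof.
move=> x1; have : (`|x| ^+ 2 = x * conjc x) by exact: sqr_normc.
by rewrite x1 expr1n mulrC => ->.
Qed.

End ComplexAlgebra.

Section Measurability.
Context {R : realType}.
Implicit Types (f g : R[i] -> R[i]) (c : R[i]).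

Lemma measurableT_cst c : measurableT_fun (fun=> c).
Proof. by split; exact: measurable_cst. Qed.

Lemma measurableT_id : measurableT_fun (@id R[i]).
Proof.
by split; apply: continuous_measurable_fun; [exact: continuous_cos|exact: continuous_sin].
Qed.

Lemma measurableTD f g : measurableT_fun f -> measurableT_fun g ->
  measurableT_fun (fun z => f z + g z).
Proof.
move=> [fr fi] [gr gi]; split.
- apply: eq_measurable_fun (measurable_funD fr gr) => t _ /=.
  by case: (f _) (g _) => [? ?] [].
- apply: eq_measurable_fun (measurable_funD fi gi) => t _ /=.
  by case: (f _) (g _) => [? ?] [].
Qed.

Lemma measurableTM f g : measurableT_fun f -> measurableT_fun g ->
  measurableT_fun (fun z => f z * g z).
Proof.
move=> [fr fi] [gr gi]; split.
- apply: eq_measurable_fun (measurable_funB (measurable_funM fr gr)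
    (measurable_funM fi gi)) => t _ /=.
  by case: (f _) (g _) => [? ?] [].
- apply: eq_measurable_fun (measurable_funD (measurable_funM fr gi)
    (measurable_funM fi gr)) => t _ /=.
  by case: (f _) (g _) => [? ?] [].
Qed.

Lemma measurableTJ f : measurableT_fun f ->
  measurableT_fun (fun z => conjc (f z)).
Proof.
move=> [fr fi]; split.
- by apply: eq_measurable_fun fr => t _ /=; case: (f _).
- by apply: eq_measurable_fun (measurable_funN fi) => t _ /=; case: (f _).
Qed.

Lemma measurableT_sqr_normc f : measurableT_fun f ->
  measurable_fun [set: R] (fun t => normc (f (expi t)) ^+ 2).
Proof.
move=> [fr fi].
apply: eq_measurable_fun (measurable_funD (measurable_funX 2 fr)
  (measurable_funX 2 fi)) => t _ /=.
by rewrite sqr_normcE.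
Qed.

(** Everywhere, zeros included, 1/f = conj f / |f|^2, and the reciprocal of a
    nonnegative real function is its power of exponent -1. *)
Lemma measurableTV f : measurableT_fun f -> measurableT_fun (fun z => (f z)^-1).
Proof.
move=> mf.
have mV : measurable_fun [set: R] (fun t => (normc (f (expi t)) ^+ 2)^-1).
  apply: eq_measurable_fun (measurableT_comp (measurable_powR (-1))
    (measurableT_sqr_normc mf)) => t _ /=.
  by rewrite powR_inv1// sqr_ge0.
have mJ := measurableTJ mf.
have mW : measurableT_fun (fun z => ((normc (f z) ^+ 2)^-1)%:C).
  by split; [exact: mV|rewrite /=; exact: measurable_cst].
suff -> : (fun z => (f z)^-1) =
    (fun z => conjc (f z) * ((normc (f z) ^+ 2)^-1)%:C) by exact: measurableTM.
apply/funext => z; rewrite invc_norm mulrC; congr (_ * _).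
by rewrite normr_normcE -rmorphXn/= -fmorphV.
Qed.

End Measurability.

(** * Null sets of the circle *)

Section AlmostEverywhere.
Context {R : realType}.
Implicit Types P Q S : R -> Prop.

Lemma arc_ae_filter : Filter (almost_everywhere (@arc R)).
Proof. exact: ae_filter_ringOfSetsType. Qed.

Lemma aeT P : (forall t, P t) -> {ae (@arc R), forall t, P t}.
Proof. by move=> PT; exact: (@filterE _ _ arc_ae_filter P PT). Qed.

Lemma aeS P Q : (forall t, P t -> Q t) ->
  {ae (@arc R), forall t, P t} -> {ae (@arc R), forall t, Q t}.
Proof. by move=> PQ H; exact: (@filterS _ _ arc_ae_filter _ _ PQ H). Qed.

Lemma aeS2 P Q S : (forall t, P t -> Q t -> S t) ->
  {ae (@arc R), forall t, P t} -> {ae (@arc R), forall t, Q t} ->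
  {ae (@arc R), forall t, S t}.
Proof. by move=> PQS; exact: (@filterS2 _ _ arc_ae_filter _ _ _ PQS). Qed.

End AlmostEverywhere.

(** * The inner product of L^2(T) *)

Section SquareIntegrable.
Context {R : realType}.
Implicit Types (f g h : R[i] -> R[i]) (c : R[i]).

Local Notation sq f := (fun t => normc (f (expi t)) ^+ 2).
Local Notation summable u := (arc.-integrable [set: measurableTypeR R] (EFin \o u)).

Definition nsq f : R := (\int[arc]_t normc (f (expi t)) ^+ 2)%R.

(** The real part of <f, g>. This real inner product carries the whole Hilbert
    space structure, because Im <f, g> = Re <f, i g>; in particular, orthogonality
    to a complex subspace can be tested with it. *)
Definition rdot f g : R := complex.Re (dotT f g).

Lemma L2norm_sqrt f : L2norm f = sqrte (\int[arc]_t (normc (f (expi t)) ^+ 2)%:E)%E.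
Proof.
rewrite /L2norm unlock poweR12_sqrt; last first.
  by apply: integral_ge0 => t _; exact: poweR_ge0.
congr sqrte; apply: eq_integral => t _ /=.
by rewrite ger0_norm ?normc_ge0// powR_mulrn// normc_ge0.
Qed.

Lemma L2TP f : L2T f <-> measurableT_fun f /\ summable (sq f).
Proof.
have I0 : (0 <= \int[arc]_t (normc (f (expi t)) ^+ 2)%:E)%E.
  by apply: integral_ge0 => t _; rewrite lee_fin sqr_ge0.
have IE : (\int[arc]_t `|(normc (f (expi t)) ^+ 2)%:E| =
           \int[arc]_t (normc (f (expi t)) ^+ 2)%:E)%E.
  by apply: eq_integral => t _; rewrite gee0_abs// lee_fin sqr_ge0.
rewrite /L2T /= L2norm_sqrt; split => -[mf H]; split => //.
  apply/integrableP; split.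
    by apply/measurable_EFinP; exact: measurableT_sqr_normc.
  by rewrite IE; move: I0 H; case: integral => [r| |]//= _ _; rewrite ltry.
move/integrableP : H => [_]; rewrite IE; move: I0.
by case: integral => [r| |]//= _ _; rewrite ltry.
Qed.

Lemma L2T_measurable f : L2T f -> measurableT_fun f. Proof. by case. Qed.

Lemma L2T_summable f : L2T f -> summable (sq f).
Proof. by case/L2TP. Qed.

Lemma nsqE f : L2T f -> (\int[arc]_t (normc (f (expi t)) ^+ 2)%:E)%E = (nsq f)%:E.
Proof.
move=> /L2T_summable fi; rewrite /nsq /Rintegral fineK//.
exact: integrable_fin_num.
Qed.

Lemma nsq_ge0 f : 0 <= nsq f.
Proof. by apply: Rintegral_ge0 => t _; exact: sqr_ge0. Qed.

Lemma L2norm_nsq f : L2T f -> L2norm f = (Num.sqrt (nsq f))%:E.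
Proof. by move=> Lf; rewrite L2norm_sqrt nsqE. Qed.

Lemma L2T_ae_le f g (C : R) : 0 <= C -> measurableT_fun f -> L2T g ->
  {ae arc, forall t, normc (f (expi t)) ^+ 2 <= C * normc (g (expi t)) ^+ 2} ->
  L2T f /\ nsq f <= C * nsq g.
Proof.
move=> C0 mf Lg fg.
have Dg : summable (fun t => `|C| * normc (g (expi t)) ^+ 2).
  exact: (integrableZl measurableT `|C| (L2T_summable Lg)).
have mg := measurableT_sqr_normc (L2T_measurable Lg).
have mF := measurableT_sqr_normc mf.
have le_int : (\int[arc]_t (normc (f (expi t)) ^+ 2)%:E <=
    \int[arc]_t (`|C| * normc (g (expi t)) ^+ 2)%:E)%E.
  apply: ae_ge0_le_integral => //.
  - by move=> t _; rewrite lee_fin sqr_ge0.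
  - exact/measurable_EFinP.
  - by move=> t _; rewrite lee_fin mulr_ge0// sqr_ge0.
  - by case/integrableP: Dg.
  - apply: aeS fg => t ft _; rewrite lee_fin (le_trans ft)//.
    by rewrite ler_wpM2r ?sqr_ge0// ler_norm.
have Lf : L2T f.
  apply/L2TP; split => //; apply/integrableP; split; first exact/measurable_EFinP.
  under eq_integral do rewrite /= ger0_norm ?sqr_ge0//.
  by rewrite (le_lt_trans le_int)//; exact: integrable_lty.
split => //.
rewrite -lee_fin -nsqE// (le_trans le_int)// ger0_norm//.
under eq_integral do rewrite EFinM.
rewrite integralZl//; last exact: L2T_summable.
by rewrite nsqE.
Qed.

Lemma L2T_cst c : L2T (fun=> c).
Proof.
apply/L2TP; split; first exact: measurableT_cst.
by apply: finite_measure_integrable_cst.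
Qed.

Lemma L2TD f g : L2T f -> L2T g -> L2T (fun z => f z + g z).
Proof.
move=> Lf Lg; apply/L2TP; split.
  by apply: measurableTD; exact: L2T_measurable.
(* |f + g|^2 <= |f|^2 + |g|^2 + 2 |Re (f conj g)| <= 3 (|f|^2 + |g|^2). *)
have I : summable (fun t => 3 * (normc (f (expi t)) ^+ 2 + normc (g (expi t)) ^+ 2)).
  exact: (integrableZl measurableT 3
    (integrableD measurableT (L2T_summable Lf) (L2T_summable Lg))).
apply: le_integrable I => //.
  apply/measurable_EFinP; apply: (@measurableT_sqr_normc _ (fun z => f z + g z)).
  by apply: measurableTD; exact: L2T_measurable.
move=> t _; rewrite /= lee_fin !ger0_norm ?sqr_ge0 ?mulr_ge0 ?addr_ge0 ?sqr_ge0//.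
rewrite sqr_normcD; have := normr_ReJ_le (f (expi t)) (g (expi t)).
by rewrite ler_norml => /andP[_]; lra.
Qed.

Lemma L2T_bounded_mul f g (C : R) : 0 <= C -> measurableT_fun f -> L2T g ->
  {ae arc, forall t, normc (f (expi t)) ^+ 2 <= C} ->
  L2T (fun z => f z * g z) /\ nsq (fun z => f z * g z) <= C * nsq g.
Proof.
move=> C0 mf Lg fC; apply: L2T_ae_le => //.
  by apply: measurableTM => //; exact: L2T_measurable.
by apply: aeS fC => t ft; rewrite sqr_normcM ler_wpM2r// sqr_ge0.
Qed.

Lemma L2TZ c f : L2T f -> L2T (fun z => c * f z).
Proof.
move=> Lf; apply: (L2T_bounded_mul (sqr_ge0 (normc c)) (measurableT_cst c) Lf _).1.
by apply: aeT => t; exact: lexx.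
Qed.

Lemma L2TB f g : L2T f -> L2T g -> L2T (fun z => f z - g z).
Proof.
move=> Lf Lg; have := L2TD Lf (L2TZ (-1) Lg).
by congr L2T; apply/funext => z; rewrite mulN1r.
Qed.

Lemma rdot_summable f g : L2T f -> L2T g ->
  summable (fun t => complex.Re (f (expi t) * conjc (g (expi t)))).
Proof.
move=> Lf Lg.
have I := integrableD measurableT (L2T_summable Lf) (L2T_summable Lg).
apply: le_integrable I => //.
  apply/measurable_EFinP.
  exact: (measurableTM (L2T_measurable Lf) (measurableTJ (L2T_measurable Lg))).1.
move=> t _; rewrite /= lee_fin (le_trans (normr_ReJ_le _ _))//.
by rewrite ger0_norm// addr_ge0// sqr_ge0.
Qed.

Lemma rdotC f g : rdot f g = rdot g f.
Proof.
rewrite /rdot /dotT /intT /=; apply: eq_Rintegral => t _.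
by case: (f _) (g _) => [? ?] [? ?] /=; ring.
Qed.

Lemma rdotDl f g h : L2T f -> L2T g -> L2T h ->
  rdot (fun z => f z + g z) h = rdot f h + rdot g h.
Proof.
move=> Lf Lg Lh; rewrite /rdot /dotT /intT /= -RintegralD//.
- by apply: eq_Rintegral => t _; rewrite mulrDl; case: (_ * _) (_ * _) => [? ?] [].
- exact: rdot_summable.
- exact: rdot_summable.
Qed.

Lemma rdotMl (b : R[i] -> R[i]) f g :
  rdot (fun z => b z * f z) g = rdot f (fun z => conjc (b z) * g z).
Proof.
rewrite /rdot /dotT /intT /=; apply: eq_Rintegral => t _.
by case: (f _) (g _) (b _) => [? ?] [? ?] [? ?] /=; ring.
Qed.

Lemma rdotZl (r : R) f g : L2T f -> L2T g ->
  rdot (fun z => r%:C * f z) g = r * rdot f g.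
Proof.
move=> Lf Lg; rewrite /rdot /dotT /intT /= -RintegralZl//; last first.
  exact: rdot_summable.
by apply: eq_Rintegral => t _; case: (f _) (g _) => [? ?] [? ?] /=; ring.
Qed.

Lemma rdotBl f g h : L2T f -> L2T g -> L2T h ->
  rdot (fun z => f z - g z) h = rdot f h - rdot g h.
Proof.
move=> Lf Lg Lh; rewrite -mulN1r -rdotZl// -rdotDl//; last exact: L2TZ.
by congr rdot; apply/funext => z; rewrite rmorphN1 mulN1r.
Qed.

Lemma rdotDr f g h : L2T f -> L2T g -> L2T h ->
  rdot h (fun z => f z + g z) = rdot h f + rdot h g.
Proof. by move=> *; rewrite rdotC rdotDl// !(rdotC h). Qed.

Lemma rdotBr f g h : L2T f -> L2T g -> L2T h ->
  rdot h (fun z => f z - g z) = rdot h f - rdot h g.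
Proof. by move=> *; rewrite rdotC rdotBl// !(rdotC h). Qed.

Lemma rdotZr (r : R) f g : L2T f -> L2T g ->
  rdot g (fun z => r%:C * f z) = r * rdot g f.
Proof. by move=> *; rewrite rdotC rdotZl// rdotC. Qed.

Lemma rdot_nsq f : rdot f f = nsq f.
Proof.
by rewrite /rdot /dotT /intT /=; apply: eq_Rintegral => t _; rewrite sqr_normc_ReJ.
Qed.

Lemma nsqD f g : L2T f -> L2T g ->
  nsq (fun z => f z + g z) = nsq f + nsq g + 2 * rdot f g.
Proof.
move=> Lf Lg; rewrite -!rdot_nsq rdotDl ?rdotDr//; last exact: L2TD.
by rewrite (rdotC g f); ring.
Qed.

Lemma nsqZ c f : L2T f -> nsq (fun z => c * f z) = normc c ^+ 2 * nsq f.
Proof.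
move=> Lf; rewrite -!rdot_nsq rdotMl -rdotZr//; congr rdot.
apply/funext => z; rewrite mulrA; congr (_ * _).
by rewrite rmorphXn/= -normr_normcE (sqr_normc c) mulrC.
Qed.

(** Cauchy-Schwarz: the quadratic |f + r g|^2 in r is nonnegative at its minimum
    r = - <f, g> / |g|^2. When |g| = 0 it is affine in r, and a nonzero slope
    would make it equal to -1 at a suitable r. *)
Lemma rdot_sqr_le f g : L2T f -> L2T g -> rdot f g ^+ 2 <= nsq f * nsq g.
Proof.
move=> Lf Lg.
have pos (r : R) : 0 <= nsq f + r ^+ 2 * nsq g + 2 * (r * rdot f g).
  rewrite -rdotZr// [r ^+ 2 * _](_ : _ = nsq (fun z => r%:C * g z)); last first.
    by rewrite nsqZ//= expr0n/= addr0 sqr_sqrtr// sqr_ge0.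
  by rewrite -nsqD//; [exact: nsq_ge0|exact: L2TZ].
have [g0|g0] := eqVneq (nsq g) 0.
  rewrite g0 mulr0.
  have [->|d0] := eqVneq (rdot f g) 0; first by rewrite expr0n.
  have := pos (- (nsq f + 1) / (2 * rdot f g)).
  rewrite g0 mulr0 addr0 => H; exfalso; move: H.
  rewrite (_ : 2 * _ = - (nsq f + 1)); last by field.
  by rewrite opprD addNKr ler0N1.
have gp : 0 < nsq g by rewrite lt_neqAle eq_sym g0 nsq_ge0.
have := pos (- rdot f g / nsq g); rewrite -(pmulr_lge0 _ gp) => H.
rewrite -subr_ge0; apply: le_trans H _.
by rewrite le_eqVlt; apply/orP; left; apply/eqP; field.
Qed.

End SquareIntegrable.

(** * Integrals of trigonometric functions *)

Section Characters.
Context {R : realType}.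
Implicit Types (f g h : R[i] -> R[i]) (c : R[i]).

Lemma expiX (t : R) n : expi t ^+ n = expi (n%:R * t).
Proof.
elim: n => [|n IH]; first by rewrite expr0 mul0r /expi cos0 sin0.
rewrite exprSr IH -natr1 mulrDl mul1r /expi cosD sinD; simpc.
by congr (_ +i* _); rewrite addrC.
Qed.

Lemma expi_unit (t : R) : conjc (expi t) * expi t = 1.
Proof.
rewrite /expi; simpc; apply/eqP; rewrite eq_complex/=; apply/andP; split; apply/eqP.
  by rewrite -!expr2 cos2Dsin2.
by ring.
Qed.

Lemma sqr_normc_expi (t : R) : normc (expi t) ^+ 2 = 1.
Proof. by rewrite sqr_normcE /= cos2Dsin2. Qed.

Lemma expi2pi n : expi (n%:R * (2 * pi)) = 1 :> R[i].
Proof.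
by rewrite -expiX (_ : 2 * pi = pi *+ 2) ?mulr_natl// /expi sin2pi cos2pi expr1n.
Qed.

Lemma is_derive_trig (A B M k x : R) :
  is_derive x 1 (fun t => A * sin (k * t) + B * cos (k * t) + M * t)
    (k * (A * cos (k * x) - B * sin (k * x)) + M).
Proof.
have dl (a : R) : is_derive x 1 (fun t => a * t) a.
  have H : is_derive x (1 : R) (a \*: @id R) (a * 1) :=
    is_deriveZ a (is_derive_id x (1 : R)).
  apply: is_derive_eq H _; exact: mulr1.
have ds := is_derive1_comp (is_derive_sin (k * x)) (dl k).
have dc := is_derive1_comp (is_derive_cos (k * x)) (dl k).
have H := is_deriveD (is_deriveD (is_deriveZ A ds) (is_deriveZ B dc)) (dl M).
apply: is_derive_eq H _.
by rewrite /GRing.scale/=; ring.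
Qed.

Lemma Rintegral_arc_cst (r : R) : (\int[arc]_t r = r)%R.
Proof.
rewrite Rintegral_cst//; apply: etrans (mulr1 r); congr (_ * _).
exact: (congr1 fine (probability_setT arc)).
Qed.

(** A periodic primitive takes the same value at 0 and 2 pi. The constant M makes
    the integrand nonnegative, so that its integral against arc length is an
    integral over [0, 2 pi]. *)
Lemma int_trig (A B : R) n :
  arc.-integrable [set: measurableTypeR R]
    (EFin \o (fun t => A * cos (n.+1%:R * t) - B * sin (n.+1%:R * t))) ->
  (\int[arc]_t (A * cos (n.+1%:R * t) - B * sin (n.+1%:R * t)) = 0)%R.
Proof.
set k : R := n.+1%:R => Iu; set u := fun t : R => _ in Iu *.
have k0 : 0 < k by rewrite ltr0n.
pose M := k * (`|A| + `|B|).
have v0 t : 0 <= k * u t + M.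
  rewrite /M -mulrDr mulr_ge0 ?(ltW k0)// /u.
  have c1 := cos_max (k * t); have s1 := sin_max (k * t).
  have hc : `|A * cos (k * t)| <= `|A| by rewrite normrM ler_piMr.
  have hs : `|B * sin (k * t)| <= `|B| by rewrite normrM ler_piMr.
  by move: hc hs; rewrite !ler_norml => /andP[? ?] /andP[? ?]; lra.
pose F t := A * sin (k * t) + B * cos (k * t) + M * t.
have dF t : is_derive t (1 : R) F (k * u t + M) by exact: is_derive_trig.
have cF t : {for t, continuous F}.
  apply/differentiable_continuous/derivable1_diffP.
  exact: (@ex_derive _ _ _ _ _ _ _ (dF t)).
have cu : continuous (fun t => k * u t + M).
  move=> t; apply/differentiable_continuous/derivable1_diffP.
  have d := is_deriveD (is_derive_trig (- k * B) (k * A) 0 k t)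
    (is_derive_cst M t (1 : R)).
  have -> : (fun t => k * u t + M) = (fun t => - k * B * sin (k * t) +
      k * A * cos (k * t) + 0 * t) + cst M.
    by apply/funext => r; rewrite fctE /cst /u; ring.
  exact: (@ex_derive _ _ _ _ _ _ _ d).
have Iv : (\int[arc]_t (k * u t + M)%:E = M%:E)%E.
  rewrite /arc integral_uniform//; last first.
    by apply/measurable_EFinP; exact: continuous_measurable_fun.
  rewrite (@continuous_FTC2 _ _ F) ?mulr_gt0 ?pi_gt0//.
  - have FE : F (2 * pi) - F 0 = M * (2 * pi).
      have := expi2pi n.+1; rewrite /expi -/k => -[c1 s1].
      by rewrite /F /= c1 s1 !mulr0 cos0 sin0; ring.
    rewrite -EFinB -EFinM FE subr0; congr EFin.
    by rewrite mulrC mulfK// gt_eqF// twopi_gt0.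
  - by apply: continuous_subspaceT; exact: cu.
  - split => [t _| |].
    + exact: (@ex_derive _ _ _ _ _ _ _ (dF t)).
    + by apply: cvg_at_right_filter; exact: cF.
    + by apply: cvg_at_left_filter; exact: cF.
  - by move=> t _; rewrite derive1E; exact: (@derive_val _ _ _ _ _ _ _ (dF t)).
have : (\int[arc]_t (k * u t + M) = M)%R by rewrite /Rintegral Iv.
rewrite RintegralD//; last 2 first.
- exact: (integrableZl measurableT k Iu).
- exact: finite_measure_integrable_cst.
rewrite RintegralZl// Rintegral_arc_cst => /eqP.
by rewrite -subr_eq0 addrK mulf_eq0 gt_eqF//= => /eqP.
Qed.

End Characters.

(** * Fourier series and polynomial approximation *)

Section Polynomials.
Context {R : realType}.
Implicit Types (f g : R[i] -> R[i]) (a b : nat -> R[i]) (c d : R[i]) (q : {poly R[i]}).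

Lemma L2T_monomial c k : L2T (fun z => c * z ^+ k : R[i]).
Proof.
apply: L2TZ; have := @L2T_ae_le R (fun z => z ^+ k) (fun=> 1) 1 ler01.
case=> //.
- elim: k => [|k IH]; first exact: measurableT_cst.
  rewrite (_ : (fun z => _) = fun z => id z * z ^+ k); last first.
    by apply/funext => z; rewrite exprS.
  by apply: measurableTM; [exact: measurableT_id|exact: IH].
- exact: L2T_cst.
- by apply: aeT => t; rewrite expiX sqr_normc_expi Normc.normc1 expr1n mulr1.
Qed.

(** On T, z^j conj (z^k) = z^(j - k) for k <= j. *)
Lemma rdot_monomial c d j k :
  rdot (fun z => c * z ^+ j) (fun z => d * z ^+ k) =
  if j == k then complex.Re (c * conjc d) else 0.
Proof.
wlog jk : j k c d / (k <= j)%N => [H|].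
  have [/H//|/ltnW/H jk] := leqP k j.
  rewrite rdotC jk eq_sym; case: ifP => // _.
  by case: c d => [? ?] [? ?] /=; ring.
have E t : c * expi t ^+ j * conjc (d * expi t ^+ k) =
    c * conjc d * expi ((j - k)%:R * t) :> R[i].
  rewrite -{1}(subnK jk) exprD rmorphM rmorphXn/= -expiX.
  rewrite -[RHS]mulr1 -(expr1n _ k) -(expi_unit t) exprMn; ring.
have [jk0|jk0] := eqVneq j k.
  rewrite /rdot /dotT /intT /= -[RHS]Rintegral_arc_cst.
  by apply: eq_Rintegral => t _; rewrite E jk0 subnn mul0r /expi cos0 sin0 mulr1.
have [n jkn] : exists n, (j - k = n.+1)%N.
  by exists (j - k).-1; rewrite prednK// subn_gt0 ltn_neqAle eq_sym jk0.
set C := c * conjc d in E.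
have ET t : complex.Re (c * expi t ^+ j * conjc (d * expi t ^+ k)) =
    complex.Re C * cos (n.+1%:R * t) - complex.Im C * sin (n.+1%:R * t).
  by rewrite E jkn /expi; case: (C) => x y.
have := rdot_summable (L2T_monomial c j) (L2T_monomial d k).
rewrite /rdot /dotT /intT /=.
under [X in _ -> X = _]eq_Rintegral do rewrite ET.
rewrite (_ : EFin \o _ = EFin \o (fun t =>
    complex.Re C * cos (n.+1%:R * t) - complex.Im C * sin (n.+1%:R * t))).
  by move/int_trig.
by apply/funext => t /=; rewrite ET.
Qed.

(** The Fourier coefficient <f, z^k>. *)
Definition coef f k : R[i] :=
  rdot f (fun z => 1 * z ^+ k) +i* rdot f (fun z => 'i * z ^+ k).

Lemma rdot_coef f c k : L2T f ->
  rdot f (fun z => c * z ^+ k) = complex.Re (coef f k * conjc c).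
Proof.
move=> Lf; case: c => x y.
rewrite (_ : (fun z => _) = (fun z => x%:C * (1 * z ^+ k) + y%:C * ('i * z ^+ k))).
  rewrite rdotDr//; try by apply: L2TZ; exact: L2T_monomial.
  rewrite (rdotZr x (L2T_monomial 1 k) Lf) (rdotZr y (L2T_monomial 'i k) Lf).
  by rewrite /coef /=; ring.
apply/funext => z; rewrite mul1r mulrA -mulrDl; congr (_ * _).
by simpc.
Qed.

Definition psum a n (z : R[i]) : R[i] := \sum_(k < n) a k * z ^+ k.

Lemma psumS a n : psum a n.+1 = fun z => psum a n z + a n * z ^+ n.
Proof. by apply/funext => z; rewrite /psum big_ord_recr. Qed.

Lemma psum0 a : psum a 0 = fun=> 0.
Proof. by apply/funext => z; rewrite /psum big_ord0. Qed.

Lemma L2T_psum a n : L2T (psum a n).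
Proof.
elim: n => [|n IH]; first by rewrite psum0; exact: L2T_cst.
by rewrite psumS; apply: L2TD => //; exact: L2T_monomial.
Qed.

Lemma rdot0r f : rdot f (fun=> 0) = 0.
Proof.
have E (x : R[i]) : complex.Re (x * conjc 0) = 0 by rewrite conjc0 mulr0.
rewrite /rdot /dotT /intT -[RHS]Rintegral_arc_cst.
by apply: eq_Rintegral => t _; exact: E.
Qed.

Lemma rdot_psum f a n : L2T f ->
  rdot f (psum a n) = \sum_(k < n) complex.Re (coef f k * conjc (a k)).
Proof.
move=> Lf; elim: n => [|n IH]; first by rewrite psum0 rdot0r big_ord0.
rewrite psumS rdotDr//; [|exact: L2T_psum|exact: L2T_monomial].
by rewrite IH rdot_coef// big_ord_recr.
Qed.

Lemma rdot_psum_monomial a n c k : (k < n)%N ->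
  rdot (psum a n) (fun z => c * z ^+ k) = complex.Re (a k * conjc c).
Proof.
move=> kn; have : rdot (psum a n) (fun z => c * z ^+ k) =
    if (k < n)%N then complex.Re (a k * conjc c) else 0.
  elim: n {kn} => [|n IH]; first by rewrite psum0 rdotC rdot0r.
  rewrite psumS rdotDl//; try exact: L2T_monomial; last exact: L2T_psum.
  rewrite IH rdot_monomial ltnS (leq_eqVlt k n) (eq_sym n k).
  by case: eqVneq => [->|_] /=; rewrite ?ltnn ?add0r ?addr0.
by rewrite kn.
Qed.

Lemma coef_psum a n k : (k < n)%N -> coef (psum a n) k = a k.
Proof.
move=> kn; rewrite /coef !rdot_psum_monomial// rmorph1 mulr1.
by case: (a k) => x y; simpc.
Qed.

Lemma nsq_psum a n : nsq (psum a n) = \sum_(k < n) normc (a k) ^+ 2.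
Proof.
rewrite -rdot_nsq rdot_psum; last exact: L2T_psum.
by apply: eq_bigr => k _; rewrite coef_psum// sqr_normc_ReJ.
Qed.

(** The n-th partial Fourier sum is the orthogonal projection onto the
    polynomials of degree < n. *)
Lemma rdot_sub_psum f b n : L2T f ->
  rdot (fun z => f z - psum (coef f) n z) (psum b n) = 0.
Proof.
move=> Lf; rewrite rdotBl ?rdot_psum//; try exact: L2T_psum.
rewrite -[RHS](subrr (\sum_(k < n) complex.Re (coef f k * conjc (b k)))).
by congr (_ - _); apply: eq_bigr => k _; rewrite coef_psum.
Qed.

Lemma bessel f n : L2T f ->
  nsq f = nsq (fun z => f z - psum (coef f) n z) +
          \sum_(k < n) normc (coef f k) ^+ 2.
Proof.
move=> Lf; have LS := L2T_psum (coef f) n.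
have := nsqD (L2TB Lf LS) LS; rewrite rdot_sub_psum// mulr0 addr0 nsq_psum => <-.
by congr nsq; apply/funext => z; rewrite subrK.
Qed.

Lemma psum_best f b n : L2T f ->
  nsq (fun z => f z - psum (coef f) n z) <= nsq (fun z => f z - psum b n z).
Proof.
move=> Lf; have LS := L2T_psum (coef f) n.
pose b' k := coef f k - b k.
have E : psum b' n = fun z => psum (coef f) n z - psum b n z.
  apply/funext => z; rewrite /psum -sumrB; apply: eq_bigr => k _.
  by rewrite mulrBl.
have -> : (fun z => f z - psum b n z) =
    fun z => f z - psum (coef f) n z + psum b' n z.
  by apply/funext => z; rewrite E addrA subrK.
rewrite (nsqD (L2TB Lf LS) (L2T_psum b' n)).
by rewrite rdot_sub_psum// mulr0 addr0 lerDl nsq_ge0.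
Qed.

Lemma psum_horner q n : (size q <= n)%N ->
  psum (fun k => q`_k) n = fun z => q.[z].
Proof. by move=> qn; apply/funext => z; rewrite (horner_coef_wide _ qn). Qed.

Lemma L2T_poly q : L2T (fun z => q.[z]).
Proof. by rewrite -(psum_horner (leqnn (size q))); exact: L2T_psum. Qed.

Lemma L2norm_cvg0 (u : nat -> R[i] -> R[i]) : (forall n, L2T (u n)) ->
  (forall e, 0 < e -> exists N, forall n, (N <= n)%N -> nsq (u n) < e) ->
  L2norm (u n) @[n --> \oo] --> 0%E.
Proof.
move=> Lu H; under eq_fun do rewrite L2norm_nsq//.
apply: cvg_EFin; first exact: nearW.
apply/cvgrPdist_lt => e e0; have [N HN] := H (e ^+ 2) (exprn_gt0 _ e0).
exists N => // n /= /HN un; rewrite sub0r normrN ger0_norm ?sqrtr_ge0//.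
by rewrite -(ger0_norm (ltW e0)) -sqrtr_sqr ltr_sqrt// exprn_gt0.
Qed.

Lemma L2norm_cvg0_nsq (u : nat -> R[i] -> R[i]) e : (forall n, L2T (u n)) ->
  L2norm (u n) @[n --> \oo] --> 0%E -> 0 < e -> exists n, nsq (u n) < e.
Proof.
move=> Lu; under eq_fun do rewrite L2norm_nsq//.
move=> /fine_cvgP[_ /cvgrPdist_lt H] e0.
have se : 0 < Num.sqrt e by rewrite sqrtr_gt0.
have [N _ HN] := H _ se; exists N; have := HN N (leqnn _).
by rewrite /= sub0r normrN ger0_norm ?sqrtr_ge0// ltr_sqrt.
Qed.

(** Partial Fourier sums are best approximations, so that approximability by some
    polynomials is the convergence of the Fourier series. *)
Lemma H2P f : H2 f <->
  L2T f /\ forall e, 0 < e -> exists q : {poly R[i]}, nsq (fun z => f z - q.[z]) < e.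
Proof.
split=> [[Lf [a [_ fa]]]|[Lf fq]]; split => //.
  move=> e e0.
  have Lu n : L2T (fun z => f z - psum a n z) by apply: L2TB => //; exact: L2T_psum.
  have [n fn] := L2norm_cvg0_nsq Lu fa e0.
  exists (\poly_(k < n) a k); apply: le_lt_trans fn.
  rewrite le_eqVlt; apply/orP; left; apply/eqP; congr nsq; apply/funext => z.
  by rewrite horner_poly.
exists (coef f); split.
  apply: nondecreasing_is_cvgn.
    apply/nondecreasing_seqP => n; rewrite seriesSr lerDl sqr_ge0//.
  exists (nsq f) => _ [n _ <-]; rewrite (bessel n Lf) /series/= big_mkord.
  by rewrite lerDr nsq_ge0.
apply: (@L2norm_cvg0 (fun n z => f z - psum (coef f) n z)) => [n|e e0].
  by apply: L2TB => //; exact: L2T_psum.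
have [q fqe] := fq e e0; exists (size q) => n qn.
apply: le_lt_trans fqe; have := psum_best (fun k => q`_k) n Lf.
by rewrite (psum_horner qn).
Qed.

End Polynomials.

(** * Completeness of L^2(T) *)

Section Completeness.
Context {R : realType}.
Implicit Types (f g h u w : R[i] -> R[i]) (a : nat -> R[i]) (c : R[i]).

Lemma nsqBC f g : nsq (fun z => f z - g z) = nsq (fun z => g z - f z).
Proof.
apply: eq_Rintegral => t _; rewrite -opprB !sqr_normcE.
by case: (_ - _) => x y /=; rewrite !sqrrN.
Qed.

Lemma L2T_le_integral u (C : R) : measurableT_fun u ->
  (\int[arc]_t (normc (u (expi t)) ^+ 2)%:E <= C%:E)%E -> L2T u /\ nsq u <= C.
Proof.
move=> mu uC; have Lu : L2T u.
  apply/L2TP; split => //; apply/integrableP; split.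
    by apply/measurable_EFinP; exact: measurableT_sqr_normc.
  under eq_integral do rewrite /= ger0_norm ?sqr_ge0//.
  by rewrite (le_lt_trans uC)// ltry.
by split => //; rewrite -lee_fin -nsqE.
Qed.

(** A pointwise limit that is measurable even where the sequence diverges. It is
    taken in z, not in the parameter t, so that it is again a function on T. *)
Definition limsupT (F : nat -> R[i] -> R[i]) (z : R[i]) : R[i] :=
  fine (limn_esup (fun k => (complex.Re (F k z))%:E)) +i*
  fine (limn_esup (fun k => (complex.Im (F k z))%:E)).

Lemma measurableT_limsupT (F : nat -> R[i] -> R[i]) :
  (forall k, measurableT_fun (F k)) -> measurableT_fun (limsupT F).
Proof.
move=> mF; split.
- apply: (@measurableT_comp _ _ _ _ _ _ (@fine R)) => //.
  apply: measurable_fun_limn_esup => k; apply/measurable_EFinP.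
  exact: (mF k).1.
- apply: (@measurableT_comp _ _ _ _ _ _ (@fine R)) => //.
  apply: measurable_fun_limn_esup => k; apply/measurable_EFinP.
  exact: (mF k).2.
Qed.

Lemma limsupT_cvg (F : nat -> R[i] -> R[i]) z :
  cvgn (fun k => complex.Re (F k z)) -> cvgn (fun k => complex.Im (F k z)) ->
  complex.Re (F k z) @[k --> \oo] --> complex.Re (limsupT F z) /\
  complex.Im (F k z) @[k --> \oo] --> complex.Im (limsupT F z).
Proof.
have fineK (v : R^nat) : cvgn v ->
    v k @[k --> \oo] --> fine (limn_esup (fun k => (v k)%:E)).
  move=> /cvg_ex[l vl].
  have vE : (fun k => (v k)%:E) x @[x --> \oo] --> l%:E.
    by apply: cvg_EFin => //; exact: nearW.
  by rewrite (cvg_limn_einf_sup vE).2.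
by move=> cr ci; split; exact: fineK.
Qed.

(** The series of the increments converges absolutely. *)
Lemma cvg_bounded_increments (v D : R^nat) :
  (forall k, `|v k.+1 - v k| <= D k) -> cvgn (series D) -> cvgn v.
Proof.
move=> vD cD; have D0 k : 0 <= D k by exact: le_trans (vD k).
have : cvgn (series (telescope v)).
  by apply: normed_cvg; apply: (@series_le_cvg _ _ D) => [k|//|k|//];
    [exact: normr_ge0|exact: vD].
move=> cv; have -> : v = (fun n => v 0%N + series (telescope v) n).
  by apply/funext => n; exact: eq_sum_telescope.
by apply: is_cvgD => //; exact: is_cvg_cst.
Qed.

Let r (k : nat) : R := 1 / (2 ^ k.+1)%:R.

Let r_gt0 k : 0 < r k.
Proof. by rewrite divr_gt0// ltr0n expn_gt0. Qed.

Let r_sum : (\sum_(k <oo) (r k)%:E <= 1%:E)%E.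
Proof. exact: (@epsilon_trick0 R 1 xpredT ler01). Qed.

Let r_cvg : cvgn (series r).
Proof.
apply: nnseries_is_cvg => [k|]; first exact/ltW.
by rewrite (le_lt_trans r_sum)// ltry.
Qed.

(** The function sum_k |G_(k+1) - G_k|^2 / r_k has integral at most sum_k r_k, so
    it is finite almost everywhere; and an increment d is at most d^2 / r_k + r_k,
    which makes the increments summable there. *)
Lemma fast_cauchy_ae_cvg (G : nat -> R[i] -> R[i]) : (forall k, L2T (G k)) ->
  (forall k, nsq (fun z => G k.+1 z - G k z) <= r k ^+ 2) ->
  {ae arc, forall t, cvgn (fun k => complex.Re (G k (expi t))) /\
                     cvgn (fun k => complex.Im (G k (expi t)))}.
Proof.
move=> LG Gr.
have LD k : L2T (fun z => G k.+1 z - G k z) by exact: L2TB.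
pose w k t := (r k)^-1 * normc (G k.+1 (expi t) - G k (expi t)) ^+ 2.
have w0 k t : 0 <= w k t by rewrite mulr_ge0 ?sqr_ge0// invr_ge0 ltW.
have mw k : measurable_fun [set: measurableTypeR R] (fun t => (w k t)%:E).
  apply/measurable_EFinP; apply: measurable_funM; first exact: measurable_cst.
  exact: (measurableT_sqr_normc (L2T_measurable (LD k))).
have Iw k : (\int[arc]_t (w k t)%:E <= (r k)%:E)%E.
  under eq_integral do rewrite EFinM.
  rewrite integralZl//; last exact: (L2T_summable (LD k)).
  rewrite (nsqE (LD k)) -EFinM lee_fin ler_pdivrMl//; exact: Gr.
pose E t := (\sum_(k <oo) (w k t)%:E)%E.
have E0 t : (0 <= E t)%E by apply: nneseries_ge0 => k _ _; rewrite lee_fin.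
have IE : arc.-integrable [set: measurableTypeR R] E.
  apply/integrableP; split.
    by apply: ge0_emeasurable_sum => // k t _ _; rewrite lee_fin.
  under eq_integral do rewrite gee0_abs//.
  rewrite /E integral_nneseries//; last by move=> k t _; rewrite lee_fin.
  apply: (@le_lt_trans _ _ 1%:E); last by rewrite ltry.
  apply: le_trans r_sum; apply: lee_nneseries => // k _ _.
  by apply: integral_ge0 => t _; rewrite lee_fin.
have fE : {ae arc, forall t, (E t < +oo)%E}.
  have := integrable_ae measurableT IE.
  by apply: aeS => t /(_ I); rewrite ge0_fin_numE.
apply: aeS fE => t Et.
have cw : cvgn (series (w ^~ t)) by exact: nnseries_is_cvg.
have cD : cvgn (series (fun k => w k t + r k)) by exact: is_cvg_seriesD.
have dw k : normc (G k.+1 (expi t) - G k (expi t)) <= w k t + r k.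
  rewrite /w; set d := normc _; have d0 : 0 <= d := normc_ge0 _.
  (* With r = r k: either d <= r, or d <= d^2 / r. *)
  have [dr|/ltW rd] := leP d (r k).
    by rewrite (le_trans dr)// lerDr mulr_ge0 ?sqr_ge0// invr_ge0 ltW.
  rewrite -[leLHS]addr0 lerD ?(ltW (r_gt0 k))// mulrC ler_pdivlMr//.
  by rewrite expr2 ler_wpM2l.
split; apply: cvg_bounded_increments cD => k; apply: le_trans (dw k).
- apply: le_trans (normr_Re_le _).
  by case: (G k.+1 _) (G k _) => [? ?] [].
- apply: le_trans (normr_Im_le _).
  by case: (G k.+1 _) (G k _) => [? ?] [].
Qed.

(** Fatou's lemma for the functions |G_k - f|^2. *)
Lemma nsq_ae_lim_le (G : nat -> R[i] -> R[i]) h f (C : R) :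
  (forall k, L2T (G k)) -> measurableT_fun h -> L2T f ->
  {ae arc, forall t,
     complex.Re (G k (expi t)) @[k --> \oo] --> complex.Re (h (expi t)) /\
     complex.Im (G k (expi t)) @[k --> \oo] --> complex.Im (h (expi t))} ->
  (\forall k \near \oo, nsq (fun z => G k z - f z) <= C) ->
  L2T (fun z => h z - f z) /\ nsq (fun z => h z - f z) <= C.
Proof.
move=> LG mh Lf Gh GC.
have LD k : L2T (fun z => G k z - f z) by exact: L2TB.
have mD k : measurable_fun [set: measurableTypeR R]
    (fun t => (normc (G k (expi t) - f (expi t)) ^+ 2)%:E).
  apply/measurable_EFinP.
  exact: (measurableT_sqr_normc (L2T_measurable (LD k))).
have mhf : measurableT_fun (fun z => h z - f z).
  have := measurableTD mh (L2T_measurable (L2TZ (-1) Lf)).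
  by congr measurableT_fun; apply/funext => z; rewrite mulN1r.
apply: L2T_le_integral => //.
have -> : (\int[arc]_t (normc (h (expi t) - f (expi t)) ^+ 2)%:E =
    \int[arc]_t limn_einf (fun k => (normc (G k (expi t) - f (expi t)) ^+ 2)%:E))%E.
  apply: ae_eq_integral => //.
  - apply/measurable_EFinP; exact: (measurableT_sqr_normc mhf).
  - rewrite (_ : (fun t => _) = fun t => - limn_esup (fun k =>
        - (normc (G k (expi t) - f (expi t)) ^+ 2)%:E))%E; last first.
      by apply/funext => t; rewrite limn_esupN oppeK.
    apply: measurableT_comp => //.
    by apply: measurable_fun_limn_esup => k; exact: measurableT_comp.
  - apply: aeS Gh => t [cr ci] _; apply/esym.
    apply: (cvg_limn_einf_sup _).1; apply: cvg_EFin; first exact: nearW.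
    rewrite sqr_normcE; under eq_fun do rewrite sqr_normcE.
    have ReB (x y : R[i]) : complex.Re (x - y) = complex.Re x - complex.Re y.
      by case: x y => [? ?] [].
    have ImB (x y : R[i]) : complex.Im (x - y) = complex.Im x - complex.Im y.
      by case: x y => [? ?] [].
    under eq_fun do rewrite ReB ImB.
    rewrite ReB ImB !expr2; under eq_fun do rewrite !expr2.
    by apply: cvgD; apply: cvgM; apply: cvgB => //; exact: cvg_cst.
apply: le_trans (fatou arc measurableT mD _) _ => [k t _|].
  by rewrite lee_fin sqr_ge0.
under eq_fun do rewrite (nsqE (LD _)).
rewrite limn_einf_lim; apply: lime_le; first exact: is_cvg_einfs.
apply: filterS GC => k GkC; apply: ge_ereal_inf.
by exists (nsq (fun z => G k z - f z))%:E; [exists k => /=|rewrite lee_fin].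
Qed.

(** A subsequence with increments below r k in norm converges almost everywhere,
    and Fatou's lemma makes its pointwise limit the norm limit of the sequence. *)
Theorem L2T_complete (F : nat -> R[i] -> R[i]) : (forall n, L2T (F n)) ->
  (forall e, 0 < e -> exists N, forall m n, (N <= m)%N -> (N <= n)%N ->
     nsq (fun z => F m z - F n z) < e) ->
  exists2 h, L2T h & forall e, 0 < e -> exists N, forall n, (N <= n)%N ->
     nsq (fun z => h z - F n z) < e.
Proof.
move=> LF cauchy.
have /choice[N HN] : forall k, exists N, forall m n, (N <= m)%N -> (N <= n)%N ->
    nsq (fun z => F m z - F n z) < r k ^+ 2.
  by move=> k; apply: cauchy; rewrite exprn_gt0.
(* Summing makes the chosen indices nondecreasing, adding k makes them
   unbounded. *)
pose phi k := (\sum_(j < k.+1) N j + k)%N.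
have phiN k : (N k <= phi k)%N.
  by rewrite /phi big_ord_recr/= addnAC leq_addl.
have phiS k : (phi k <= phi k.+1)%N.
  by rewrite /phi (big_ord_recr k.+1)/= leq_add// leq_addr.
pose G k := F (phi k).
have LG k : L2T (G k) by exact: LF.
have Gr k : nsq (fun z => G k.+1 z - G k z) <= r k ^+ 2.
  by apply/ltW/HN; [exact: leq_trans (phiS k)|exact: phiN].
pose h := limsupT G.
have mh : measurableT_fun h by apply: measurableT_limsupT => k; case: (LG k).
have Gh : {ae arc, forall t,
    complex.Re (G k (expi t)) @[k --> \oo] --> complex.Re (h (expi t)) /\
    complex.Im (G k (expi t)) @[k --> \oo] --> complex.Im (h (expi t))}.
  by apply: aeS (fast_cauchy_ae_cvg LG Gr) => t [cr ci]; exact: limsupT_cvg.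
have near_h e : 0 < e -> exists N0, forall n, (N0 <= n)%N ->
    L2T (fun z => h z - F n z) /\ nsq (fun z => h z - F n z) < e.
  move=> e0; have e2 : 0 < e / 2 by rewrite divr_gt0.
  have [N0 H0] := cauchy _ e2.
  exists N0 => n nN.
  have [] := @nsq_ae_lim_le G h (F n) (e / 2) LG mh (LF n) Gh.
    exists N0 => // k /= Nk; apply/ltW/H0 => //.
    by rewrite (leq_trans Nk)// leq_addl.
  move=> L1 L2; split => //; apply: le_lt_trans L2 _.
  by rewrite ltr_pdivrMr// ltr_pMr// ltr1n.
exists h.
  have [N0 /(_ N0 (leqnn _))[L0 _]] := near_h 1 ltr01.
  have := L2TD L0 (LF N0); congr L2T; apply/funext => z; exact: subrK.
by move=> e /near_h[N0 H]; exists N0 => n /H[].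
Qed.

End Completeness.

(** * The projection onto H^2 and kernels of Toeplitz operators *)

Section Projection.
Context {R : realType}.
Implicit Types (f g h u w : R[i] -> R[i]) (c : R[i]) (q : {poly R[i]}).

Lemma H2_L2T f : H2 f -> L2T f. Proof. by case. Qed.

Lemma nsq_eq0 f : L2T f -> nsq f = 0 <-> eqT f (fun=> 0).
Proof.
move=> Lf; have mf := measurableT_sqr_normc (L2T_measurable Lf).
have sqr0 (x : R[i]) : normc x ^+ 2 = 0 <-> x = 0.
  split=> [/eqP|->]; last by rewrite Normc.normc0 expr0n.
  by rewrite expf_eq0/= => /eqP/Normc.eq0_normc.
have H := ae_eq_integral_abs arc measurableT
  (iffRL (measurable_EFinP _ _) mf).
split=> [f0|f0].
  have : (\int[arc]_t `|(normc (f (expi t)) ^+ 2)%:E| = 0)%E.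
    under eq_integral do rewrite /= ger0_norm ?sqr_ge0//.
    by rewrite nsqE// f0.
  by move/H; apply: aeS => t /(_ I)[/sqr0].
apply/eqP; rewrite eq_le nsq_ge0 andbT.
have [] := @L2T_ae_le R f (fun=> 0) 0 (lexx _) (L2T_measurable Lf) (L2T_cst 0).
  by apply: aeS f0 => t ->; rewrite Normc.normc0 expr0n mulr0.
by rewrite mul0r.
Qed.

Lemma rdot_null w g : L2T w -> L2T g -> nsq w = 0 -> rdot w g = 0.
Proof.
move=> Lw Lg w0; have := rdot_sqr_le Lw Lg.
by rewrite w0 mul0r le_eqVlt ltNge sqr_ge0 orbF sqrf_eq0 => /eqP.
Qed.

(** Orthogonality passes to norm limits, by Cauchy-Schwarz. *)
Lemma rdot0_lim w g : L2T w -> L2T g ->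
  (forall e, 0 < e -> exists g', [/\ L2T g', nsq (fun z => g z - g' z) < e &
     rdot w g' = 0]) -> rdot w g = 0.
Proof.
move=> Lw Lg H; apply/eqP/negPn/negP => d0.
have d2 : 0 < rdot w g ^+ 2 by rewrite exprn_even_gt0.
have w1 : 0 < nsq w + 1 by rewrite ltr_wpDl ?nsq_ge0.
have [g' [Lg' gg' wg']] := H _ (divr_gt0 d2 w1).
have := rdot_sqr_le Lw (L2TB Lg Lg').
rewrite rdotBr// wg' subr0 leNgt => /negP; apply.
apply: (@le_lt_trans _ _ ((nsq w + 1) * nsq (fun z => g z - g' z))).
  by rewrite ler_wpM2r ?nsq_ge0// lerDl.
by rewrite -ltr_pdivlMl// mulrC.
Qed.

Lemma rdot_poly0 w q : L2T w ->
  (forall c k, rdot w (fun z => c * z ^+ k) = 0) -> rdot w (fun z => q.[z]) = 0.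
Proof.
move=> Lw w0; rewrite -(psum_horner (leqnn (size q))) rdot_psum//.
by apply: big1 => k _; rewrite -rdot_coef.
Qed.

(** By density of the polynomials, orthogonality to H^2 is orthogonality to the
    monomials. *)
Lemma H2_rdot0 w g : L2T w -> (forall c k, rdot w (fun z => c * z ^+ k) = 0) ->
  H2 g -> rdot w g = 0.
Proof.
move=> Lw w0 /H2P[Lg gq]; apply: rdot0_lim => // e /gq[q gqe].
by exists (fun z => q.[z]); split => //; [exact: L2T_poly|exact: rdot_poly0].
Qed.

Lemma sum_ord_geq (V : nmodType) (F : nat -> V) m n : (m <= n)%N ->
  \sum_(k < n) (if (k < m)%N then 0 else F k) = \sum_(m <= k < n) F k.
Proof.
move=> mn; rewrite -(big_mkord xpredT (fun k => if (k < m)%N then 0 else F k)).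
rewrite (big_cat_nat (leq0n m) mn)/= [X in X + _]big1_seq ?add0r.
  by apply: eq_big_nat => k /andP[mk _]; rewrite ltnNge mk.
by move=> k /=; rewrite mem_index_iota => /andP[_ ->].
Qed.

Lemma psum_sub (a : nat -> R[i]) m n : (m <= n)%N ->
  (fun z => psum a n z - psum a m z) =
  psum (fun k => if (k < m)%N then 0 else a k) n.
Proof.
move=> mn; apply/funext => z; rewrite /psum.
under [RHS]eq_bigr do rewrite (fun_if ( *%R^~ _)) mul0r.
rewrite (sum_ord_geq (fun k => a k * z ^+ k) mn).
rewrite -!(big_mkord xpredT (fun k => a k * z ^+ k)).
by rewrite (big_cat_nat (leq0n m) mn)/= addrAC subrr add0r.
Qed.

Lemma nsq_psum_sub (a : nat -> R[i]) m n : (m <= n)%N ->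
  nsq (fun z => psum a n z - psum a m z) =
  \sum_(k < n) normc (a k) ^+ 2 - \sum_(k < m) normc (a k) ^+ 2.
Proof.
move=> mn; rewrite psum_sub// nsq_psum.
under eq_bigr do rewrite (fun_if (fun x => normc x ^+ 2)) Normc.normc0 expr0n/=.
rewrite (sum_ord_geq (fun k => normc (a k) ^+ 2) mn).
rewrite -!(big_mkord xpredT (fun k => normc (a k) ^+ 2)).
by rewrite (big_cat_nat (leq0n m) mn)/= addrAC subrr add0r.
Qed.

(** By Bessel's inequality the series of the |<u, z^k>|^2 converges; its remainders
    bound the distances between partial Fourier sums. *)
Lemma psum_coef_cauchy u : L2T u ->
  forall e, 0 < e -> exists N, forall m n, (N <= m)%N -> (N <= n)%N ->
    nsq (fun z => psum (coef u) m z - psum (coef u) n z) < e.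
Proof.
move=> Lu e e0; pose s n := \sum_(k < n) normc (coef u k) ^+ 2.
have s_nd : {homo s : m n / (m <= n)%N >-> m <= n}.
  by apply/nondecreasing_seqP => n; rewrite /s big_ord_recr/= lerDl sqr_ge0.
have s_cvg : cvgn s.
  apply: nondecreasing_is_cvgn => //; exists (nsq u) => _ [n _ <-].
  by rewrite (bessel n Lu) lerDr nsq_ge0.
have s_le n : s n <= limn s by exact: nondecreasing_cvgn_le.
have [N _ HN] : \forall n \near \oo, limn s - s n < e.
  move/cvgrPdist_lt : s_cvg => /(_ _ e0); apply: filterS => n.
  by rewrite ger0_norm// subr_ge0.
exists N => m n; wlog nm : m n / (n <= m)%N => [H Nm Nn|Nm Nn].
  by have [/H->//|/ltnW/H] := leqP n m; rewrite nsqBC => ->.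
rewrite nsq_psum_sub//; apply: le_lt_trans (HN n Nn).
by rewrite lerD2r; exact: s_le.
Qed.

(** The projection is the sum h of the Fourier series sum_k <u, z^k> z^k, k >= 0,
    which is in H^2 as a limit of polynomials; u - h is orthogonal to z^k because
    u minus a partial sum is, from the k-th sum on. *)
Lemma H2_projection_rdot u : L2T u ->
  exists2 h, H2 h & forall g, H2 g -> rdot (fun z => u z - h z) g = 0.
Proof.
move=> Lu; have LS n : L2T (psum (coef u) n) by exact: L2T_psum.
have [h Lh Sh] := L2T_complete LS (psum_coef_cauchy Lu).
exists h.
  apply/H2P; split => // e /Sh[N /(_ N (leqnn _)) hN].
  exists (\poly_(k < N) coef u k); rewrite (_ : (fun z => _) =
    fun z => h z - psum (coef u) N z)//.
  by apply/funext => z; rewrite horner_poly.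
have Luh := L2TB Lu Lh.
move=> g; apply: H2_rdot0 => // c k; rewrite rdotC.
apply: rdot0_lim => //; first exact: L2T_monomial.
move=> e /Sh[N HN]; exists (fun z => u z - psum (coef u) (maxn N k.+1) z).
split; first exact: L2TB.
  rewrite (_ : (fun z => _) = fun z => psum (coef u) (maxn N k.+1) z - h z).
    by rewrite nsqBC; apply: HN; exact: leq_maxl.
  by apply/funext => z; ring.
rewrite rdotC rdotBl//; last exact: L2T_monomial.
by rewrite rdot_coef// rdot_psum_monomial ?subrr// leq_maxr.
Qed.

Lemma Im_dotT f g :
  complex.Im (dotT f g) = rdot f (fun z => 'i * g z).
Proof.
rewrite /rdot /dotT /intT /=; apply: eq_Rintegral => t _.
by case: (f _) (g _) => [? ?] [? ?] /=; ring.
Qed.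

Lemma H2Z c f : H2 f -> H2 (fun z => c * f z).
Proof.
move=> /H2P[Lf fq]; apply/H2P; split; first exact: L2TZ.
move=> e e0; have c1 : 0 < normc c ^+ 2 + 1 by rewrite ltr_wpDl ?sqr_ge0.
have [q qe] := fq _ (divr_gt0 e0 c1); exists (c *: q).
rewrite (_ : (fun z => _) = fun z => c * (f z - q.[z])); last first.
  by apply/funext => z; rewrite hornerZ mulrBr.
rewrite nsqZ; last by apply: L2TB => //; exact: L2T_poly.
apply: (@le_lt_trans _ _ ((normc c ^+ 2 + 1) * nsq (fun z => f z - q.[z]))).
  by rewrite ler_wpM2r ?nsq_ge0// lerDl.
by rewrite -ltr_pdivlMl// mulrC.
Qed.

Lemma dotT_H2_orthP w : (forall g, H2 g -> dotT w g = 0) <->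
  (forall g, H2 g -> rdot w g = 0).
Proof.
split=> w0 g Hg; first by rewrite /rdot w0.
have := w0 _ (H2Z 'i Hg); have := w0 g Hg; rewrite -Im_dotT /rdot.
by case: (dotT w g) => a b /= -> ->.
Qed.

Lemma Pplus_spec u : L2T u -> is_H2_projection u (Pplus u).
Proof.
move=> /H2_projection_rdot[h Hh uh]; rewrite /Pplus.
apply: (@xgetPex _ _ (is_H2_projection u)); exists h; split => //.
exact/dotT_H2_orthP.
Qed.

(** P^+ (g f) and g f have the same inner products with H^2, and a function of
    H^2 orthogonal to H^2 is null. *)
Lemma ker_toeplitzP (g f : R[i] -> R[i]) : L2T (fun z => g z * f z) ->
  ker_toeplitz g f <->
  H2 f /\ forall k, H2 k -> rdot (fun z => g z * f z) k = 0.
Proof.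
move=> Lgf; have [HP /dotT_H2_orthP PO] := Pplus_spec Lgf.
have LP := H2_L2T HP.
have split_rdot k : H2 k -> rdot (fun z => g z * f z) k =
    rdot (toeplitz g f) k.
  move=> Hk; apply/eqP; rewrite -subr_eq0 -rdotBl//; last exact: H2_L2T.
  by apply/eqP; exact: PO.
rewrite /ker_toeplitz /=; split=> -[Hf H]; split => //.
  move=> k Hk; rewrite split_rdot//; apply: rdot_null => //; first exact: H2_L2T.
  exact/nsq_eq0.
by apply/nsq_eq0 => //; rewrite -rdot_nsq -split_rdot// H.
Qed.

End Projection.

(** * Multipliers of H^2 *)

Section Multipliers.
Context {R : realType}.
Implicit Types (b f g h u v w : R[i] -> R[i]) (c p : R[i]) (q : {poly R[i]}).

Lemma rdot_eqT u v g : L2T u -> L2T v -> L2T g -> eqT u v -> rdot u g = rdot v g.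
Proof.
move=> Lu Lv Lg uv; apply/eqP; rewrite -subr_eq0 -rdotBl//; apply/eqP.
apply: rdot_null => //; first exact: L2TB.
apply/nsq_eq0; first exact: L2TB.
by apply: aeS uv => t ->; rewrite subrr.
Qed.

(** The parallelogram law without its term |f - g|^2. *)
Lemma nsqD_le f g : L2T f -> L2T g ->
  nsq (fun z => f z + g z) <= 2 * nsq f + 2 * nsq g.
Proof.
move=> Lf Lg; rewrite nsqD//; have := nsq_ge0 (fun z => f z - g z).
by rewrite -rdot_nsq rdotBl ?rdotBr ?rdot_nsq ?(rdotC g f)//;
  [move=> ?; lra|exact: L2TB].
Qed.

Lemma H2_lim f : L2T f ->
  (forall e, 0 < e -> exists2 g, H2 g & nsq (fun z => f z - g z) < e) -> H2 f.
Proof.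
move=> Lf fg; apply/H2P; split => // e e0.
have e4 : 0 < e / 4 by rewrite divr_gt0.
have [g /H2P[Lg gq] fge] := fg _ e4; have [q gqe] := gq _ e4.
exists q; have := nsqD_le (L2TB Lf Lg) (L2TB Lg (L2T_poly q)).
rewrite (_ : (fun z => f z - g z + _) = fun z => f z - q.[z]); first by lra.
by apply/funext => z; ring.
Qed.

Lemma H2D f g : H2 f -> H2 g -> H2 (fun z => f z + g z).
Proof.
move=> /H2P[Lf fq] /H2P[Lg gq]; apply/H2P; split; first exact: L2TD.
move=> e e0; have e4 : 0 < e / 4 by rewrite divr_gt0.
have [q qe] := fq _ e4; have [q' qe'] := gq _ e4; exists (q + q').
have := nsqD_le (L2TB Lf (L2T_poly q)) (L2TB Lg (L2T_poly q')).
rewrite (_ : (fun z => _ + _ - _) = fun z => f z - q.[z] + (g z - q'.[z])).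
  by lra.
by apply/funext => z; rewrite hornerD; ring.
Qed.

Lemma H2B f g : H2 f -> H2 g -> H2 (fun z => f z - g z).
Proof.
move=> Hf /(H2Z (-1)) Hg; have := H2D Hf Hg.
by congr H2; apply/funext => z; rewrite mulN1r.
Qed.

Lemma H2_0 : H2 (fun=> 0 : R[i]).
Proof.
apply/H2P; split; first exact: L2T_cst.
move=> e e0; exists 0; rewrite (_ : (fun z => _) = fun=> 0).
  by rewrite (nsq_eq0 (L2T_cst 0)).2//; exact: aeT.
by apply/funext => z; rewrite horner0 subr0.
Qed.

Lemma H2_sum (F : nat -> R[i] -> R[i]) n : (forall k, H2 (F k)) ->
  H2 (fun z => \sum_(k < n) F k z).
Proof.
move=> HF; elim: n => [|n IH].
  by rewrite (_ : (fun z => _) = fun=> 0);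
    [exact: H2_0|apply/funext => z; rewrite big_ord0].
rewrite (_ : (fun z => _) = fun z => \sum_(k < n) F k z + F n z).
  exact: H2D.
by apply/funext => z; rewrite big_ord_recr.
Qed.

(** Multiplication by z is an isometry of L^2(T) that preserves polynomials. *)
Lemma H2_shift f : H2 f -> H2 (fun z => z * f z).
Proof.
move=> /H2P[Lf fq].
have mul_id g : L2T g -> L2T (fun z => z * g z) /\
    nsq (fun z => z * g z) <= 1 * nsq g.
  move=> Lg; apply: L2T_bounded_mul => //; first exact: measurableT_id.
  by apply: aeT => t; rewrite sqr_normc_expi.
apply/H2P; split; first exact: (mul_id f Lf).1.
move=> e /fq[q qe]; exists ('X * q); apply: le_lt_trans qe.
rewrite (_ : (fun z => _) = fun z => z * (f z - q.[z])); last first.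
  by apply/funext => z; rewrite hornerM hornerX mulrBr.
by have [_] := mul_id _ (L2TB Lf (L2T_poly q)); rewrite mul1r.
Qed.

(** By shift invariance b z^k is in H^2, hence so is b q for each polynomial q;
    and multiplication by b is bounded on L^2. *)
Lemma H2_bounded_mul b f (C : R) : 0 <= C -> H2 b ->
  {ae arc, forall t, normc (b (expi t)) ^+ 2 <= C} -> H2 f ->
  H2 (fun z => b z * f z).
Proof.
move=> C0 Hb bC Hf; have mb := L2T_measurable (H2_L2T Hb).
have [Lf fq] := (H2P f).1 Hf.
have mulb g (Lg : L2T g) := L2T_bounded_mul C0 mb Lg bC.
apply: H2_lim => [|e e0]; first exact: (mulb f Lf).1.
have C1 : 0 < C + 1 by rewrite ltr_wpDl.
have [q qe] := fq _ (divr_gt0 e0 C1).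
exists (fun z => b z * q.[z]).
  have Hbk k : H2 (fun z => b z * z ^+ k).
    elim: k => [|k /H2_shift].
      by rewrite (_ : (fun z => _) = b)//; apply/funext => z; rewrite mulr1.
    by congr H2; apply/funext => z; rewrite exprS mulrCA.
  rewrite (_ : (fun z => _) =
      fun z => \sum_(k < size q) q`_k * (b z * z ^+ k)).
    by apply: (H2_sum (F := fun k z => q`_k * (b z * z ^+ k))) => k; exact: H2Z.
  apply/funext => z; rewrite horner_coef mulr_sumr; apply: eq_bigr => k _.
  by rewrite mulrCA.
rewrite (_ : (fun z => _) = fun z => b z * (f z - q.[z])); last first.
  by apply/funext => z; rewrite mulrBr.
apply: le_lt_trans (mulb _ (L2TB Lf (L2T_poly q))).2 _.
apply: (@le_lt_trans _ _ ((C + 1) * nsq (fun z => f z - q.[z]))).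
  by rewrite ler_wpM2r ?nsq_ge0// lerDl.
by rewrite -ltr_pdivlMl// mulrC.
Qed.

Lemma inner_normc w : inner_function w ->
  {ae arc, forall t, normc (w (expi t)) ^+ 2 = 1}.
Proof.
by move=> [_]; apply: aeS => t; rewrite normr_normcE => -[->]; rewrite expr1n.
Qed.

Lemma inner_normc_le w : inner_function w ->
  {ae arc, forall t, normc (w (expi t)) ^+ 2 <= 1}.
Proof. by move/inner_normc; apply: aeS => t ->. Qed.

Lemma H2_inner_mul w f : inner_function w -> H2 f -> H2 (fun z => w z * f z).
Proof.
move=> iw; apply: (H2_bounded_mul ler01); first by case: iw.
exact: inner_normc_le.
Qed.

Lemma inner_mul v w : inner_function v -> inner_function w ->
  inner_function (fun z => v z * w z).
Proof.
move=> iv iw; split; first by apply: H2_inner_mul => //; case: iw.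
by case: iv iw => [_ v1] [_]; apply: aeS2 v1 => t v1 w1; rewrite normrM v1 w1 mulr1.
Qed.

Section Resolvent.
Variables (p : R[i]) (w : R[i] -> R[i]).
Hypotheses (p1 : normc p < 1) (iw : inner_function w).

Let k z := (1 - p * w z)^-1.

Lemma normc_resolvent_ge : {ae arc, forall t,
  1 - normc p <= normc (1 - p * w (expi t))}.
Proof.
apply: aeS iw.2 => t w1; have := le_normcD (1 - p * w (expi t)) (p * w (expi t)).
rewrite subrK Normc.normc1 Normc.normcM.
have -> : normc (w (expi t)) = 1 by move: w1; rewrite normr_normcE => -[].
by rewrite mulr1; lra.
Qed.

Lemma resolvent_neq0 : {ae arc, forall t, 1 - p * w (expi t) != 0}.
Proof.
apply: aeS normc_resolvent_ge => t; apply: contraTN => /eqP ->.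
by rewrite Normc.normc0 -ltNge subr_gt0.
Qed.

Lemma measurableT_resolvent : measurableT_fun k.
Proof.
apply: measurableTV.
have mw : measurableT_fun w by case: iw => /H2_L2T[].
have := measurableTD (measurableT_cst 1) (measurableTM (measurableT_cst (- p)) mw).
by congr measurableT_fun; apply/funext => z; rewrite mulNr.
Qed.

Let C := ((1 - normc p) ^-1) ^+ 2.

Lemma normc_resolvent_le : {ae arc, forall t, normc (k (expi t)) ^+ 2 <= C}.
Proof.
apply: aeS normc_resolvent_ge => t H.
have p1' : 0 < 1 - normc p by rewrite subr_gt0.
rewrite Normc.normcV; apply: lerXn2r; rewrite ?nnegrE ?invr_ge0 ?normc_ge0 ?(ltW p1')//.
by rewrite lef_pV2// posrE// (lt_le_trans p1').
Qed.

Lemma sqr_normcX (x : R[i]) n : normc (x ^+ n) ^+ 2 = (normc x ^+ 2) ^+ n.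
Proof.
elim: n => [|n IH]; first by rewrite Normc.normc1 expr1n.
by rewrite (exprS x) sqr_normcM IH -exprS.
Qed.

Lemma H2_powers f n : H2 f -> H2 (fun z => (p * w z) ^+ n * f z).
Proof.
move=> Hf; elim: n => [|n /(H2_inner_mul iw)/(H2Z p)].
  by move: Hf; congr H2; apply/funext => z; rewrite mul1r.
by congr H2; apply/funext => z; rewrite exprS; ring.
Qed.

(** Since |p w| = |p| < 1 on T, k is the uniform limit of the partial sums of the
    geometric series in p w, which multiply H^2 into itself. *)
Lemma H2_resolvent f : H2 f -> H2 (fun z => k z * f z).
Proof.
move=> Hf; have Lf := H2_L2T Hf.
have C0 : 0 <= C by exact: sqr_ge0.
have mulk g (Lg : L2T g) :=
  L2T_bounded_mul C0 measurableT_resolvent Lg normc_resolvent_le.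
apply: H2_lim => [|e e0]; first exact: (mulk f Lf).1.
have pn_ge0 n : 0 <= (normc p ^+ 2) ^+ n by rewrite exprn_ge0// sqr_ge0.
have np : `|normc p ^+ 2| < 1.
  by rewrite ger0_norm ?sqr_ge0// expr_lt1 ?normc_ge0.
have [n Hn] : exists n, C * (normc p ^+ 2) ^+ n * (nsq f + 1) < e.
  have f1 : 0 < C * (nsq f + 1) + 1 by rewrite ltr_wpDl// mulr_ge0// addr_ge0 ?nsq_ge0.
  have /cvgrPdist_lt /(_ _ (divr_gt0 e0 f1)) [N _ /(_ N (leqnn _))] := cvg_expr np.
  rewrite /= sub0r normrN ger0_norm ?pn_ge0// ltr_pdivlMr// => H.
  exists N; apply: le_lt_trans H; rewrite mulrAC mulrC ler_wpM2l ?lerDl//.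
pose S z := \sum_(j < n) (p * w z) ^+ j * f z.
have HS : H2 S by apply: (H2_sum (F := fun j z => (p * w z) ^+ j * f z)) => j;
  exact: H2_powers.
exists S => //; apply: le_lt_trans Hn.
have mkS : measurableT_fun (fun z => k z * f z - S z).
  by apply: L2T_measurable; apply: L2TB; [exact: (mulk f Lf).1|exact: H2_L2T].
apply: (@le_trans _ _ (C * (normc p ^+ 2) ^+ n * nsq f)); last first.
  by rewrite ler_wpM2l ?lerDl// mulr_ge0// exprn_ge0// sqr_ge0.
apply: (@L2T_ae_le R _ f (C * (normc p ^+ 2) ^+ n) _ mkS Lf _).2.
  by rewrite mulr_ge0// exprn_ge0// sqr_ge0.
have tail t : normc (w (expi t)) ^+ 2 = 1 -> 1 - p * w (expi t) != 0 ->
    normc (k (expi t) * f (expi t) - S (expi t)) ^+ 2 =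
    normc (k (expi t)) ^+ 2 * ((normc p ^+ 2) ^+ n * normc (f (expi t)) ^+ 2).
  move=> w1 d0; rewrite /S -mulr_suml -mulrBl.
  have -> : k (expi t) - \sum_(j < n) (p * w (expi t)) ^+ j =
      k (expi t) * (p * w (expi t)) ^+ n.
    apply: (mulfI d0); rewrite mulrBr mulrA /k divff// mul1r.
    set x := p * w _; set s := \sum_(j < n) _.
    have -> : x ^+ n = (x - 1) * s + 1 by rewrite -subrX1 subrK.
    by ring.
  by rewrite !sqr_normcM sqr_normcX sqr_normcM w1 mulr1 mulrA.
have tail_ae := aeS2 tail (inner_normc iw) resolvent_neq0.
apply: aeS2 tail_ae normc_resolvent_le => t -> kC.
by rewrite -[leRHS]mulrA; apply: ler_wpM2r => //; rewrite mulr_ge0 ?pn_ge0 ?sqr_ge0.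
Qed.

End Resolvent.

End Multipliers.

(** * The Crofoot multiplier *)

Lemma poisson_kernel (R : rcfType) (c x y : R[i]) :
  conjc c * c = 1 - x * conjc x -> 1 - x != 0 ->
  conjc (c * (1 - x)^-1) * (c * (1 - x)^-1 * y) =
  y + x * (1 - x)^-1 * y + conjc (x * (1 - x)^-1) * y.
Proof.
move=> cx d0; have d0' : 1 - conjc x != 0.
  by rewrite -(rmorph1 conjc) -rmorphB conjc_eq0.
have E : conjc ((1 - x)^-1) = (1 - conjc x)^-1.
  by rewrite conjc_inv rmorphB rmorph1.
rewrite !rmorphM/= E.
have -> : conjc c * (1 - conjc x)^-1 * (c * (1 - x)^-1 * y) =
    (conjc c * c) * ((1 - conjc x)^-1 * (1 - x)^-1 * y) by ring.
by rewrite cx; field; rewrite d0 d0'.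
Qed.

Section Crofoot.
Context {R : realType}.
Variables (theta alpha : R[i] -> R[i]) (p : R[i]).
Hypotheses (theta_inner : inner_function theta)
  (alpha_inner : inner_function alpha) (p_lt1 : normc p < 1).
Implicit Types (f g u : R[i] -> R[i]).

Let w z := alpha z * theta z.
Let w_inner : inner_function w := inner_mul alpha_inner theta_inner.
Let k z := (1 - p * w z)^-1.
Let c : R[i] := (Num.sqrt (1 - normc p ^+ 2))%:C.
Let symbol z := conjc (theta z) - p * alpha z.

Let sqrt_gt0 : 0 < 1 - normc p ^+ 2.
Proof. by rewrite subr_gt0 expr_lt1// normc_ge0. Qed.

Let c_neq0 : c != 0.
Proof. by rewrite eq_complex/= eqxx andbT gt_eqF// sqrtr_gt0. Qed.

Let conjc_mul_c : conjc c * c = 1 - p * conjc p.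
Proof.
have -> : p * conjc p = (normc p ^+ 2)%:C.
  by rewrite rmorphXn/= -normr_normcE (sqr_normc p).
rewrite /c conjc_real -rmorphM -expr2 sqr_sqrtr ?(ltW sqrt_gt0)//.
by rewrite rmorphB rmorph1.
Qed.

Lemma inner_conj_mulL2 b f : inner_function b -> L2T f ->
  L2T (fun z => conjc (b z) * f z).
Proof.
move=> ib Lf; apply: (L2T_bounded_mul ler01 _ Lf _).1.
  by apply: measurableTJ; case: ib => /H2_L2T[].
apply: aeS (inner_normc_le ib) => t; rewrite !sqr_normcE.
by case: (b _) => x y /=; rewrite sqrrN.
Qed.

Lemma model_spaceP f : model_space theta f <->
  H2 f /\ forall g, H2 g -> rdot (fun z => conjc (theta z) * f z) g = 0.
Proof.
have Lker : H2 f -> L2T (fun z => conjc (theta z) * f z).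
  by move=> /H2_L2T; exact: inner_conj_mulL2.
split=> [Kf|[Hf O]].
  have Hf : H2 f by case: Kf.
  exact/(ker_toeplitzP (Lker Hf)).
exact/(ker_toeplitzP (Lker Hf)).
Qed.

Lemma model_spaceB f g : model_space theta f -> model_space theta g ->
  model_space theta (fun z => f z - g z).
Proof.
move=> /model_spaceP[Hf Of] /model_spaceP[Hg Og].
apply/model_spaceP; split; first exact: H2B.
move=> h Hh; have Ltf := inner_conj_mulL2 theta_inner (H2_L2T Hf).
have Ltg := inner_conj_mulL2 theta_inner (H2_L2T Hg).
rewrite (_ : (fun z => _) =
    fun z => conjc (theta z) * f z - conjc (theta z) * g z).
  by rewrite rdotBl// ?Of ?Og ?subrr//; exact: H2_L2T.
by apply/funext => z; rewrite mulrBr.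
Qed.

Lemma L2T_symbol_mul f : H2 f -> L2T (fun z => symbol z * f z).
Proof.
move=> Hf; have Lf := H2_L2T Hf.
have := L2TB (inner_conj_mulL2 theta_inner Lf)
  (H2_L2T (H2Z p (H2_inner_mul alpha_inner Hf))).
by congr L2T; apply/funext => z; rewrite /symbol; ring.
Qed.

Lemma ker_symbolP f : ker_toeplitz symbol f <->
  H2 f /\ forall g, H2 g -> rdot (fun z => symbol z * f z) g = 0.
Proof.
split=> [Kf|[Hf O]].
  have Hf : H2 f by case: Kf.
  exact/(ker_toeplitzP (L2T_symbol_mul Hf)).
exact/(ker_toeplitzP (L2T_symbol_mul Hf)).
Qed.

(** The reason is conj theta theta = 1 on T. *)
Let symbolE : {ae arc, forall t,
  symbol (expi t) = conjc (theta (expi t)) * (1 - p * w (expi t))}.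
Proof.
apply: aeS theta_inner.2 => t th1.
rewrite /symbol /w mulrBr mulr1; congr (_ - _).
by rewrite !mulrA [_ * p]mulrC -!mulrA [conjc _ * _]mulrCA mulcJ_unit// mulr1.
Qed.

Lemma L2T_conj_resolvent_mul f : L2T f -> L2T (fun z => conjc (k z) * f z).
Proof.
have mk : measurableT_fun k by exact: measurableT_resolvent.
move=> Lf; apply: (L2T_bounded_mul (sqr_ge0 _) (measurableTJ mk) Lf _).1.
apply: aeS (normc_resolvent_le p_lt1 w_inner) => t.
by rewrite -/(k _) !sqr_normcE; case: (k _) => x y /=; rewrite sqrrN; exact.
Qed.

Lemma H2_crofoot_mul f : H2 f -> H2 (fun z => c * k z * f z).
Proof.
move=> Hf; have := H2Z c (H2_resolvent p_lt1 w_inner Hf).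
by congr H2; apply/funext => z; rewrite mulrA.
Qed.

(** On T, (conj theta - p alpha) (c k f) = c (conj theta f). *)
Lemma crofoot_mul_ker f : model_space theta f ->
  ker_toeplitz symbol (fun z => c * k z * f z).
Proof.
move=> /model_spaceP[Hf O]; have Hmf := H2_crofoot_mul Hf.
apply/ker_symbolP; split => // g Hg.
have Ltf := inner_conj_mulL2 theta_inner (H2_L2T Hf).
rewrite (@rdot_eqT _ _ (fun z => c * (conjc (theta z) * f z))).
- by rewrite rdotMl; apply: O; exact: H2Z.
- exact: L2T_symbol_mul.
- exact: L2TZ.
- exact: H2_L2T.
apply: aeS2 symbolE (resolvent_neq0 p_lt1 w_inner) => t -> d0.
by rewrite /k; field.
Qed.

(** The preimage of g is (1 - p w) g / c: this is in H^2, and on T its product with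
    conj theta is (conj theta - p alpha) g / c. *)
Lemma ker_crofoot_mul g : ker_toeplitz symbol g ->
  exists2 f, model_space theta f & eqT (fun z => c * k z * f z) g.
Proof.
move=> /ker_symbolP[Hg O].
exists (fun z => c^-1 * (g z - p * (w z * g z))); last first.
  apply: aeS (resolvent_neq0 p_lt1 w_inner) => t d0.
  by rewrite /k; field; rewrite d0 c_neq0.
have Hf : H2 (fun z => c^-1 * (g z - p * (w z * g z))).
  by apply/H2Z/H2B => //; apply/H2Z/H2_inner_mul.
apply/model_spaceP; split => // h Hh.
have Lsg := L2T_symbol_mul Hg.
rewrite (@rdot_eqT _ _ (fun z => c^-1 * (symbol z * g z))).
- by rewrite rdotMl; apply: O; exact: H2Z.
- exact/inner_conj_mulL2/H2_L2T.
- exact: L2TZ.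
- exact: H2_L2T.
by apply: aeS symbolE => t ->; ring.
Qed.

(** With x = p w, |x| = |p| on T, the weight |c|^2 / |1 - x|^2 is the Poisson
    kernel 1 + x k + conj (x k), k = 1/(1 - x). The two oscillating terms
    integrate to zero against |u|^2 because
    <x k u, u> = <p alpha k u, conj theta u> and conj theta u is orthogonal
    to H^2. *)
Lemma nsq_crofoot_mul u : model_space theta u ->
  nsq (fun z => c * k z * u z) = nsq u.
Proof.
move=> /model_spaceP[Hu O]; have Lu := H2_L2T Hu.
have Hku : H2 (fun z => k z * u z) by exact: H2_resolvent.
pose v z := p * (w z * (k z * u z)).
have Hv : H2 v by exact/H2Z/H2_inner_mul.
have vu0 : rdot v u = 0.
  rewrite (_ : v = fun z => theta z * (p * (alpha z * (k z * u z)))).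
    by rewrite rdotMl rdotC; apply: O; exact/H2Z/H2_inner_mul.
  by apply/funext => z; rewrite /v /w; ring.
have Hmu := H2_crofoot_mul Hu; have Lmu := H2_L2T Hmu.
pose v' z := conjc (p * (w z * k z)) * u z.
have Lv' : L2T v'.
  have := L2TZ (conjc p) (inner_conj_mulL2 w_inner (L2T_conj_resolvent_mul Lu)).
  congr L2T; apply/funext => z; rewrite /v' !rmorphM/=; ring.
have v'u0 : rdot v' u = 0.
  rewrite rdotMl rdotC -vu0; congr rdot; apply/funext => z.
  by rewrite conjcK /v; ring.
rewrite -rdot_nsq (rdotMl (fun z => c * k z)) rdotC.
have Lm : L2T (fun z => conjc (c * k z) * (c * k z * u z)).
  have := L2TZ (conjc c) (L2T_conj_resolvent_mul Lmu).
  by congr L2T; apply/funext => z; rewrite rmorphM/=; ring.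
rewrite (@rdot_eqT _ _ (fun z => u z + v z + v' z))//.
- rewrite rdotDl//; [|exact: L2TD (H2_L2T Hv)].
  rewrite rdotDl//; last exact: H2_L2T.
  by rewrite vu0 v'u0 !addr0 rdot_nsq.
- by apply: L2TD => //; apply: L2TD => //; exact: H2_L2T.
apply: aeS2 w_inner.2 (resolvent_neq0 p_lt1 w_inner) => t w1 d0.
have wJ := mulcJ_unit w1.
have cx : conjc c * c = 1 - (p * w (expi t)) * conjc (p * w (expi t)).
  by rewrite conjc_mul_c rmorphM/= -[p * conjc p]mulr1 -wJ; ring.
rewrite /v /v' (poisson_kernel _ cx d0) -/(k _).
by rewrite !mulrA.
Qed.

(** The conjugate of the Frostman shift is (conj theta - p alpha) conj k; moving
    conj k to the other side of the inner product leaves k g, and g -> k g is a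
    bijection of H^2, with inverse g -> (1 - p w) g. *)
Lemma ker_frostman : ker_toeplitz symbol =
  ker_toeplitz (fun z => conjc (frostman_shift theta (fun z => p * alpha z) z)).
Proof.
have frostE z : conjc (frostman_shift theta (fun z => p * alpha z) z) =
    conjc (k z) * symbol z.
  rewrite /frostman_shift rmorphM rmorphB/= conjcK mulrC; congr (conjc _ * _).
  by rewrite /k /w mulrA.
have LF f : H2 f ->
    L2T (fun z => conjc (frostman_shift theta (fun z => p * alpha z) z) * f z).
  move=> /L2T_symbol_mul/L2T_conj_resolvent_mul; congr L2T.
  by apply/funext => z; rewrite frostE mulrA.
have rdotF f g : rdot
    (fun z => conjc (frostman_shift theta (fun z => p * alpha z) z) * f z) g =
    rdot (fun z => symbol z * f z) (fun z => k z * g z).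
  have := rdotMl (fun z => conjc (k z)) (fun z => symbol z * f z) g.
  rewrite (_ : (fun z => conjc (conjc (k z)) * g z) = fun z => k z * g z).
    by move=> <-; congr rdot; apply/funext => z; rewrite frostE mulrA.
  by apply/funext => z; rewrite conjcK.
apply/seteqP; split=> f.
  move=> /ker_symbolP[Hf O]; apply/(ker_toeplitzP (LF f Hf)); split => // g Hg.
  by rewrite rdotF; apply: O; exact: H2_resolvent.
move=> Kf; have Hf : H2 f by case: Kf.
move/(ker_toeplitzP (LF f Hf)) : Kf => -[_ O].
apply/ker_symbolP; split => // g Hg.
have Hdg : H2 (fun z => g z - p * (w z * g z)) by apply/H2B/H2Z/H2_inner_mul.
rewrite -[RHS](O _ Hdg) rdotF rdotC [RHS]rdotC; apply: rdot_eqT.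
- exact: H2_L2T.
- by apply: H2_L2T; exact: H2_resolvent.
- exact: L2T_symbol_mul.
apply: aeS (resolvent_neq0 p_lt1 w_inner) => t d0.
by rewrite /k; field.
Qed.

End Crofoot.

Unset Implicit Arguments.

Theorem corollary6p4 (R : realType) (theta alpha : R[i] -> R[i]) (p : R[i])
    (theta_inner : inner_function theta) (alpha_inner : inner_function alpha)
    (p_lt1 : `|p| < 1) :
  let h : R[i] -> R[i] := fun z => p * alpha z in
  isometric_multiplier
    (crofoot_multiplier p (fun z => alpha z * theta z))
    (model_space theta)
    (ker_toeplitz (fun z => conjc (theta z) - h z)) /\
  ker_toeplitz (fun z => conjc (theta z) - h z) =
    ker_toeplitz (fun z => conjc (frostman_shift theta h z)).
Proof.
have p1 : normc p < 1 by move: p_lt1; rewrite normr_normcE ltcR.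
move=> h; split; last exact: ker_frostman.
split.
- by move=> f; exact: crofoot_mul_ker.
- move=> f g Kf Kg.
  have Kfg : model_space theta (fun z => f z - g z) by exact: model_spaceB.
  have [Hfg _] := Kfg.
  have H := nsq_crofoot_mul theta_inner alpha_inner p1 Kfg.
  rewrite (L2norm_nsq (H2_L2T Hfg)) -H -L2norm_nsq.
    by congr L2norm; apply/funext => z; rewrite mulrBr.
  by apply: H2_L2T; exact: H2_crofoot_mul.
- by move=> g; exact: ker_crofoot_mul.
Qed.
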